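(* Let $i,j\in I$ be such that there is no arrow from $j$ to $i$, and let $n$ be the number of arrows from $i$ to $j$. Then the following relations hold in $\mathcal{C}(Q)$: $$R_{\sigma_i}^{*(n+1)}*R_{\sigma_j}=R_{\sigma_i}^{*n}*R_{\sigma_j}*R_{\sigma_i},\qquad R_{\sigma_i}*R_{\sigma_j}^{*(n+1)}=R_{\sigma_j}*R_{\sigma_i}*R_{\sigma_j}^{*n}.$$
   Context: $k$ is an algebraically closed field of characteristic $0$, and $Q$ is a finite quiver without oriented cycles with vertex set $I$. $\mathbf{N}I$ is the set of vectors with nonnegative integer coordinates in the free abelian group on symbols $\sigma_i$ ($i\in I$). For $d\in\mathbf{N}I$, $R_d=\bigoplus_{\alpha:a\to b}\mathrm{Hom}_k(k^{d_a},k^{d_b})$ is the affine variety of representations of $Q$ of dimension vector $d$. For $\mathcal{A}\subset R_d$, $\mathcal{B}\subset R_e$, the set $\mathcal{A}*\mathcal{B}\subset R_{d+e}$ consists of all $X\in R_{d+e}$ for which there is an exact sequence of representations $0\to N\to X\to M\to 0$ with $M\in\mathcal{A}$, $N\in\mathcal{B}$. This operation is associative, and $\mathcal{A}^{*n}$ denotes the $n$-fold product of $\mathcal{A}$ with itself (with $\mathcal{A}^{*0}=R_0$, the unit). The composition monoid $\mathcal{C}(Q)$ is the monoid, under $*$, generated by the $R_{\sigma_i}$, $i\in I$. *)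

(* Defs.v *)
From HB Require Import structures.
From mathcomp Require Import all_boot all_order all_algebra.
From mathcomp Require Import boolp classical_sets.

Set Implicit Arguments.
Unset Strict Implicit.
Unset Printing Implicit Defensive.

Import GRing.Theory.
Local Open Scope ring_scope.

Record quiver := Quiver {
  vertex : finType;
  arrow : finType;
  src : arrow -> vertex;
  tgt : arrow -> vertex
}.
Arguments src {q} _.
Arguments tgt {q} _.

Definition arrows (Q : quiver) (i j : vertex Q) : {set arrow Q} :=
  [set a | (src a == i) && (tgt a == j)].

(* An oriented cycle is a nonempty list of arrows, each one ending where the
   next one starts and the last one ending where the first one starts; loops
   are the cycles of length one. *)
Definition acyclic (Q : quiver) : Prop :=
  forall (a : arrow Q) (p : seq (arrow Q)),
    ~~ cycle (fun b c : arrow Q => tgt b == src c) (a :: p).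

(* N I, with its pointwise addition. This is a notation so that the additive
   monoid structure of finite functions is found. *)
Notation dimvec Q := {ffun vertex Q -> nat}.

Definition sigma (Q : quiver) (i : vertex Q) : dimvec Q :=
  [ffun v => nat_of_bool (v == i)].

(* R_d. Vectors are rows, so that a matrix A in 'M_(m, n) is the linear map
   u |-> u *m A from k^m to k^n. *)
Definition rep (k : fieldType) (Q : quiver) (d : dimvec Q) :=
  forall a : arrow Q, 'M[k]_(d (src a), d (tgt a)).

Section Representations.
Variables (k : fieldType) (Q : quiver).
Implicit Types d e l m n p y z : dimvec Q.

Definition is_hom d e (X : rep k d) (Y : rep k e)
    (f : forall v, 'M[k]_(d v, e v)) : Prop :=
  forall a : arrow Q, f (src a) *m Y a = X a *m f (tgt a).

(* Exactness of 0 -> N -> X -> M -> 0: with row vectors, row_free is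
   injectivity, row_full is surjectivity, and the row space is the image. *)
Definition short_exact l p m (N : rep k l) (X : rep k p) (M : rep k m) : Prop :=
  exists (f : forall v, 'M[k]_(l v, p v)) (g : forall v, 'M[k]_(p v, m v)),
    [/\ is_hom N X f, is_hom X M g &
        forall v, [/\ row_free (f v), row_full (g v)
                    & (f v == kermx (g v))%MS]].

(* A dimension vector d together with a subset of R_d, so that products that
   lie in different R_d's can be compared. *)
Record repset := RepSet {
  rdim : dimvec Q;
  rset : set (rep k rdim)
}.
Arguments rset : clear implicits.

Definition star (A B : repset) : repset :=
  @RepSet (rdim A + rdim B)
    [set X | exists M N, [/\ rset A M, rset B N & short_exact N X M]].

Definition full_repset d : repset := @RepSet d [set: rep k d]%classic.

(* Membership in the submonoid generated by the R_(sigma_i); its unit is R_0. *)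
Inductive in_comp : repset -> Prop :=
| in_comp_unit : in_comp (full_repset 0)
| in_comp_gen (i : vertex Q) : in_comp (full_repset (sigma i))
| in_comp_star (A B : repset) : in_comp A -> in_comp B -> in_comp (star A B).

(* C(Q); the instance at the end of the file makes it a monoidType. *)
Record comp_monoid := CompMonoid {
  comp_val :> repset;
  comp_valP : in_comp comp_val
}.

Lemma comp_val_inj : injective comp_val.
Proof.
move=> [A hA] [B hB] /= eAB; subst B; by rewrite (Prop_irrelevance hA hB).
Qed.

Definition comp_one := CompMonoid in_comp_unit.
Definition comp_gen (i : vertex Q) := CompMonoid (in_comp_gen i).
Definition comp_mul (A B : comp_monoid) :=
  CompMonoid (in_comp_star (comp_valP A) (comp_valP B)).

Lemma repset_eq_family (P : forall d, set (rep k d)) d e :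
  d = e -> RepSet (P d) = RepSet (P e).
Proof. by move=> ->. Qed.

Lemma rank_row_basis (q r t : nat) (A : 'M[k]_(q, t)) :
  \rank A = r -> exists B : 'M[k]_(r, t), row_free B /\ (B :=: A)%MS.
Proof.
by move=> <-; exists (row_base A); split; [apply: row_base_free | apply: eq_row_base].
Qed.

Lemma rank_col_basis (q r t : nat) (A : 'M[k]_(t, q)) :
  \rank A = r -> exists B : 'M[k]_(t, r), row_full B /\ (kermx B :=: kermx A)%MS.
Proof.
move=> <-; exists (col_base A); split; first exact: col_base_full.
apply/eqmxP/andP; split; rewrite sub_kermx.
  by rewrite -[X in _ *m X](mulmx_base A) mulmxA mulmx_ker mul0mx.
apply/eqP/(row_free_inj (row_base_free A)).
by rewrite mul0mx -mulmxA mulmx_base mulmx_ker.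
Qed.

Lemma full_factor (q r t : nat) (g : 'M[k]_(q, r)) (A : 'M[k]_(q, t)) :
  row_full g -> kermx g *m A = 0 -> g *m (pinvmx g *m A) = A.
Proof.
move=> gfull kA; apply/eqP; rewrite mulmxA -subr_eq0 -{2}[A]mul1mx -mulmxBl.
have /submxP [D ->] : (g *m pinvmx g - 1%:M <= kermx g)%MS.
  by rewrite sub_kermx mulmxBl -mulmxA mulVpmx // mulmx1 mul1mx subrr.
by rewrite -mulmxA kA mulmx0.
Qed.

Lemma exact_mx0 (q r t : nat) (f : 'M[k]_(q, r)) (g : 'M[k]_(r, t)) :
  (f == kermx g)%MS -> f *m g = 0.
Proof. by case/andP=> + _; rewrite sub_kermx => /eqP. Qed.

Lemma exact_mx_dim (q r t : nat) (f : 'M[k]_(q, r)) (g : 'M[k]_(r, t)) :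
  row_free f -> row_full g -> (f == kermx g)%MS -> r = (t + q)%N.
Proof.
move=> /eqP ff /eqP gf fgE; have := eqmx_rank fgE.
rewrite ff mxrank_ker gf => ->.
by rewrite subnKC // -gf rank_leq_row.
Qed.

Lemma exact_mxI (q r t : nat) (f : 'M[k]_(q, r)) (g : 'M[k]_(r, t)) :
  row_free f -> row_full g -> f *m g = 0 -> r = (t + q)%N ->
  (f == kermx g)%MS.
Proof.
move=> /eqP ff /eqP gf fg0 rE.
have sub : (f <= kermx g)%MS by rewrite sub_kermx fg0.
by rewrite -(geq_leqif (mxrank_leqif_eq sub)) mxrank_ker ff gf rE addKn.
Qed.

Lemma short_exact_pullback l p y n m z (L : rep k l) (X : rep k p)
    (Y : rep k y) (N : rep k n) (M : rep k m) :
  z = n + l -> short_exact L X Y -> short_exact N Y M ->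
  exists Z : rep k z, short_exact L Z N /\ short_exact Z X M.
Proof.
move=> zE [f [g [fH gH fgE]]] [f' [g' [f'H g'H f'gE]]].
pose h v := g v *m g' v.
have hfull v : row_full (h v).
  have [_ gf _] := fgE v; have [_ g'f _] := f'gE v.
  by rewrite /row_full (eqmxMfull _ gf).
have dimE v : p v = (m v + z v)%N.
  have [a1 a2 a3] := fgE v; have [b1 b2 b3] := f'gE v.
  rewrite (exact_mx_dim a1 a2 a3) (exact_mx_dim b1 b2 b3) zE ffunE.
  by rewrite -addnA.
have hZ v : exists B : 'M[k]_(z v, p v), row_free B /\ (B == kermx (h v))%MS.
  have [] := @rank_row_basis _ (z v) _ (kermx (h v)).
    by rewrite mxrank_ker (eqP (hfull v)) dimE addKn.
  by move=> B [? ?]; exists B; split=> //; apply/eqmxP.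
have [i iP] := fin_all_exists hZ.
have ifree v : row_free (i v) by case: (iP v).
have iE v : (i v == kermx (h v))%MS by case: (iP v).
have subi v q (A : 'M[k]_(q, p v)) : A *m h v = 0 -> (A <= i v)%MS.
  by move=> A0; rewrite (eqmxP (iE v)) sub_kermx A0.
have hH : is_hom X M h by move=> a; rewrite /h -mulmxA g'H mulmxA gH mulmxA.
pose Z : rep k z := fun a => i (src a) *m X a *m pinvmx (i (tgt a)).
have iH : is_hom Z X i.
  move=> a; rewrite /Z mulmxKpV //; apply: subi.
  by rewrite -mulmxA -hH mulmxA (exact_mx0 (iE _)) mul0mx.
clearbody Z.
exists Z; split; last first.
  by exists i, h; split=> // v; split.
have fi0 v : f v *m h v = 0.
  by have [_ _ /exact_mx0 fg0] := fgE v; rewrite /h mulmxA fg0 mul0mx.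
pose u v := f v *m pinvmx (i v).
have uE v : u v *m i v = f v by rewrite mulmxKpV //; apply: subi.
pose w v := i v *m g v *m pinvmx (f' v).
have wE v : w v *m f' v = i v *m g v.
  rewrite mulmxKpV //; have [_ _ /eqmxP ->] := f'gE v.
  by rewrite sub_kermx -mulmxA (exact_mx0 (iE v)).
have f'free v : row_free (f' v) by case: (f'gE v).
clearbody u w h.
exists u, w; split.
- move=> a; apply: (row_free_inj (ifree (tgt a))).
  by rewrite -!mulmxA -iH uE mulmxA uE fH.
- move=> a; apply: (row_free_inj (f'free (tgt a))).
  by rewrite -mulmxA -f'H mulmxA wE -!mulmxA wE gH !mulmxA iH.
move=> v; have [ff gf fgk] := fgE v.
have ufree : row_free (u v).
  rewrite /row_free eqn_leq rank_leq_row /= -[X in (X <= _)%N](eqP ff) -(uE v).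
  exact: mxrankM_maxl.
have uw0 : u v *m w v = 0.
  apply: (row_free_inj (f'free v)).
  by rewrite -mulmxA wE mulmxA uE (exact_mx0 fgk) mul0mx.
have uwE : (u v == kermx (w v))%MS.
  apply/andP; split; first by rewrite sub_kermx uw0.
  rewrite -(submxMfree _ _ (ifree v)) uE (eqmxP fgk) sub_kermx.
  by rewrite -mulmxA -wE mulmxA mulmx_ker mul0mx.
split=> //.
have rwE := eqmx_rank uwE; rewrite (eqP ufree) mxrank_ker in rwE.
have zvE : z v = (n v + l v)%N by rewrite zE ffunE.
apply/eqP/(@addIn (l v)).
by rewrite -zvE {1}rwE subnKC // rank_leq_row.
Qed.

Lemma short_exact_pushout l p y n m z (L : rep k l) (X : rep k p)
    (Z : rep k z) (N : rep k n) (M : rep k m) :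
  y = m + n -> short_exact L Z N -> short_exact Z X M ->
  exists Y : rep k y, short_exact L X Y /\ short_exact N Y M.
Proof.
move=> yE [f [g [fH gH fgE]]] [i [h [iH hH ihE]]].
pose j v := f v *m i v.
have ifree v : row_free (i v) by case: (ihE v).
have gfull v : row_full (g v) by case: (fgE v).
have jfree v : row_free (j v).
  by have [ff _ _] := fgE v; rewrite /row_free mxrankMfree.
have dimE v : p v = (y v + l v)%N.
  have [a1 a2 a3] := fgE v; have [b1 b2 b3] := ihE v.
  rewrite (exact_mx_dim b1 b2 b3) (exact_mx_dim a1 a2 a3) yE ffunE.
  by rewrite addnA.
have hY v : exists B : 'M[k]_(p v, y v), row_full B /\ (j v == kermx B)%MS.
  have [|B [Bf Bk]] := @rank_col_basis _ (y v) _ (cokermx (j v)).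
    by rewrite mxrank_coker (eqP (jfree v)) dimE addnK.
  exists B; split=> //; apply: exact_mxI => //.
  by apply/eqP; rewrite -sub_kermx Bk sub_kermx mulmx_coker.
have [c cP] := fin_all_exists hY.
have cfull v : row_full (c v) by case: (cP v).
have cE v : (j v == kermx (c v))%MS by case: (cP v).
have kerc v q (A : 'M[k]_(p v, q)) : j v *m A = 0 -> kermx (c v) *m A = 0.
  move=> jA0; have /submxP [D ->] : (kermx (c v) <= j v)%MS.
    by rewrite (eqmxP (cE v)).
  by rewrite -mulmxA jA0 mulmx0.
have jH : is_hom L X j by move=> a; rewrite /j -mulmxA iH mulmxA fH mulmxA.
pose Y : rep k y := fun a => pinvmx (c (src a)) *m (X a *m c (tgt a)).
have cH : is_hom X Y c.
  move=> a; rewrite /Y full_factor //; apply: kerc.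
  by rewrite mulmxA jH -mulmxA (exact_mx0 (cE _)) mulmx0.
clearbody Y.
exists Y; split; first by exists j, c; split=> // v; split.
have jh0 v : j v *m h v = 0.
  by have [_ _ /exact_mx0 ih0] := ihE v; rewrite /j -mulmxA ih0 mulmx0.
pose w v := pinvmx (c v) *m h v.
have wE v : c v *m w v = h v by rewrite full_factor //; apply: kerc.
pose u v := pinvmx (g v) *m (i v *m c v).
have uE v : g v *m u v = i v *m c v.
  rewrite full_factor //; have [_ _ fgk] := fgE v.
  have /submxP [D ->] : (kermx (g v) <= f v)%MS by rewrite (eqmxP fgk).
  by rewrite -mulmxA [f v *m _]mulmxA (exact_mx0 (cE v)) mulmx0.
clearbody u w.
exists u, w; split.
- move=> a; apply: (row_full_inj (gfull (src a))).
  by rewrite mulmxA uE -mulmxA cH mulmxA iH mulmxA gH -!mulmxA uE.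
- move=> a; apply: (row_full_inj (cfull (src a))).
  by rewrite mulmxA wE hH mulmxA cH -mulmxA wE.
move=> v; have [_ hf ihk] := ihE v; have [ff _ fgk] := fgE v.
have wfull : row_full (w v).
  rewrite /row_full eqn_leq rank_leq_col /= -[X in (X <= _)%N](eqP hf) -(wE v).
  exact: mxrankM_maxr.
have uw0 : u v *m w v = 0.
  apply: (row_full_inj (gfull v)).
  by rewrite mulmxA uE -mulmxA wE (exact_mx0 ihk) mulmx0.
have yvE : y v = (m v + n v)%N by rewrite yE ffunE.
have ufree : row_free (u v).
  rewrite -kermx_eq0; set K := kermx (u v).
  have gpi : pinvmx (g v) *m g v = 1%:M by rewrite mulVpmx.
  have : (K *m pinvmx (g v) *m i v <= j v)%MS.
    rewrite (eqmxP (cE v)) sub_kermx -mulmxA -uE mulmxA -[_ *m g v]mulmxA gpi.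
    by rewrite mulmx1 mulmx_ker.
  rewrite /j submxMfree // (eqmxP fgk) sub_kermx -mulmxA gpi mulmx1.
  by [].
by split=> //; apply: exact_mxI.
Qed.

Lemma starA : associative star.
Proof.
move=> A B C; rewrite /star /=.
pose P d : set (rep k d) := fun X : rep k d => exists M N L,
  [/\ rset A M, rset B N, rset C L &
      exists Z : rep k (rdim B + rdim C), short_exact L Z N /\ short_exact Z X M].
transitivity (RepSet (P (rdim A + (rdim B + rdim C)))).
  congr RepSet; apply/seteqP; split=> X /=.
    move=> [M [Z [AM [N [L [BN CL LZN]]] ZXM]]].
    by exists M, N, L; split=> //; exists Z.
  move=> [M [N [L [AM BN CL [Z [LZN ZXM]]]]]].
  by exists M, Z; split=> //; exists N, L.
rewrite (@repset_eq_family P _ (rdim A + rdim B + rdim C) (addrA _ _ _)).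
congr RepSet; apply/seteqP; split=> X /=.
  move=> [M [N [L [AM BN CL [Z [LZN ZXM]]]]]].
  have [Y [LXY NYM]] := short_exact_pushout erefl LZN ZXM.
  by exists Y, L; split=> //; exists M, N.
move=> [Y [L [[M [N [AM BN NYM]]] CL LXY]]].
by exists M, N, L; split=> //; apply: short_exact_pullback LXY NYM.
Qed.

(* R_0 is a unit for star only for the sets that are stable under isomorphism; all the
   elements of C(Q) are. *)
Definition iso d e (X : rep k d) (Y : rep k e) : Prop :=
  exists f : forall v, 'M[k]_(d v, e v),
    is_hom X Y f /\ forall v, row_free (f v) /\ row_full (f v).

Definition iso_stable (A : repset) : Prop :=
  forall X Y : rep k (rdim A), iso X Y -> rset A X -> rset A Y.

Lemma iso_refl d (X : rep k d) : iso X X.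
Proof.
exists (fun v => 1%:M); split=> [a|v]; first by rewrite mul1mx mulmx1.
by rewrite row_free_unit row_full_unit unitmx1.
Qed.

Lemma iso_sym d (X Y : rep k d) : iso X Y -> iso Y X.
Proof.
move=> [f [fH fP]].
have fu v : f v \in unitmx by rewrite -row_free_unit; case: (fP v).
exists (fun v => invmx (f v)); split=> [a|v]; last first.
  by rewrite row_free_unit row_full_unit unitmx_inv.
apply: (can_inj (mulmxK (fu (tgt a)))).
by rewrite -!mulmxA -fH mulKmx // mulVmx // mulmx1.
Qed.

Lemma in_comp_iso_stable A : in_comp A -> iso_stable A.
Proof.
case=> [|i|B C _ _] //= X Y /iso_sym [u [uH uP]] /= [M [N [BM CN]]].
move=> [f [g [fH gH fgE]]]; exists M, N; split=> //.
have uu v : u v \in unitmx by rewrite -row_free_unit; case: (uP v).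
have ugfull v : row_full (u v *m g v).
  have [_ gf _] := fgE v; have [_ uf] := uP v.
  by rewrite /row_full (eqmxMfull _ uf).
have fufree v : row_free (f v *m invmx (u v)).
  by have [ff _ _] := fgE v; rewrite /row_free mxrankMfree // row_free_unit unitmx_inv.
exists (fun v => f v *m invmx (u v)), (fun v => u v *m g v); split.
- move=> a; apply: (can_inj (mulmxK (uu (tgt a)))).
  by rewrite -!mulmxA -uH mulKmx // mulVmx // mulmx1 fH.
- by move=> a; rewrite -mulmxA gH mulmxA uH mulmxA.
move=> v; have [ff gf fgk] := fgE v; split=> //.
apply: exact_mxI => //; last exact: exact_mx_dim ff gf fgk.
by rewrite mulmxA mulmxKV // (exact_mx0 fgk).
Qed.

Lemma mx_width0 (q r : nat) (g : 'M[k]_(q, r)) : r = 0%N -> g = 0.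
Proof. by move=> r0; subst r; apply: thinmx0. Qed.

Lemma short_exact0l d p (N : rep k (0 : dimvec Q))
    (X : rep k p) (M : rep k d) :
  short_exact N X M <-> iso X M.
Proof.
have z0 v : (0 : dimvec Q) v = 0%N by rewrite ffunE.
split=> [[f [g [_ gH fgE]]]|[g [gH gP]]].
  exists g; split=> // v; have [_ gf /andP[_ kf]] := fgE v; split=> //.
  rewrite -kermx_eq0 -mxrank_eq0 -leqn0 -[X in (_ <= X)%N](z0 v).
  exact: leq_trans (mxrankS kf) (rank_leq_row _).
exists (fun v => 0), g; split=> // [a|v]; first by rewrite mul0mx mulmx0.
have [gf gF] := gP v; split=> //; first by rewrite /row_free mxrank0 z0.
by rewrite (eqP (_ : kermx (g v) == 0)) ?kermx_eq0 // !sub0mx.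
Qed.

Lemma short_exact0r d p (N : rep k d) (X : rep k p)
    (M : rep k (0 : dimvec Q)) :
  short_exact N X M <-> iso N X.
Proof.
have z0 v : (0 : dimvec Q) v = 0%N by rewrite ffunE.
split=> [[f [g [fH _ fgE]]]|[f [fH fP]]].
  exists f; split=> // v; have [ff _ /andP[_ kf]] := fgE v; split=> //.
  by rewrite -sub1mx; apply: submx_trans kf; rewrite sub_kermx (mx_width0 (g v) (z0 v)) mulmx0.
exists f, (fun v => 0); split=> // [a|v]; first by rewrite mul0mx mulmx0.
have [ff fF] := fP v; split=> //; first by rewrite /row_full mxrank0 z0.
by rewrite sub_kermx mulmx0 eqxx /= (submx_full _ fF).
Qed.

Lemma comp_mulA : associative comp_mul.
Proof. by move=> A B C; apply: comp_val_inj; apply: starA. Qed.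

Lemma star_isoE A (P : forall d, set (rep k d)) p :
  iso_stable A -> p = rdim A ->
  (forall d (X : rep k d), P d X <-> exists2 Y, rset A Y & iso Y X) ->
  RepSet (P p) = A.
Proof.
move=> stA pE PE; rewrite (repset_eq_family P pE).
case: A stA {pE} PE => d S stA PE /=; congr RepSet.
apply/seteqP; split=> X /=; rewrite PE; first by case=> Y AY /stA; apply.
by move=> AX; exists X => //; apply: iso_refl.
Qed.

Lemma comp_mul1r : left_id comp_one comp_mul.
Proof.
move=> A; apply: comp_val_inj; rewrite /= /star /=.
apply: (@star_isoE A (fun d (X : rep k d) => exists
    (M : rep k (0 : dimvec Q)) N,
    [/\ [set: rep k 0]%classic M, rset A N & short_exact N X M])).
- exact: in_comp_iso_stable (comp_valP A).
- by rewrite add0r.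
move=> d X /=; split=> [[M [N [_ AN /short_exact0r NX]]]|[N AN NX]].
  by exists N.
by exists (fun a => 0), N; split=> //; apply/short_exact0r.
Qed.

Lemma iso_sym_gen d e (X : rep k d) (Y : rep k e) : iso X Y -> iso Y X.
Proof.
move=> XY; have dE : d = e.
  case: XY => f [_ fP]; apply/ffunP => v; have [/eqP ff /eqP fF] := fP v.
  by rewrite -[LHS]ff fF.
by subst e; apply: iso_sym.
Qed.

Lemma comp_mulr1 : right_id comp_one comp_mul.
Proof.
move=> A; apply: comp_val_inj; rewrite /= /star /=.
apply: (@star_isoE A (fun d (X : rep k d) => exists M
    (N : rep k (0 : dimvec Q)),
    [/\ rset A M, [set: rep k 0]%classic N & short_exact N X M])).
- exact: in_comp_iso_stable (comp_valP A).
- by rewrite addr0.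
move=> d X /=; split=> [[M [N [AM _ /short_exact0l XM]]]|[M AM MX]].
  by exists M => //; apply: iso_sym_gen.
exists M, (fun a => 0); split=> //; apply/short_exact0l; exact: iso_sym_gen.
Qed.

HB.instance Definition _ := gen_eqMixin comp_monoid.
HB.instance Definition _ := gen_choiceMixin comp_monoid.
HB.instance Definition _ :=
  isMonoid.Build comp_monoid comp_mulA comp_mul1r comp_mulr1.

End Representations.
Arguments comp_gen k {Q} i.

(* Main.v *)
Require Import Defs.
From mathcomp Require Import all_boot all_order all_algebra.
From mathcomp Require Import zify.
From mathcomp Require classical_sets.

Set Implicit Arguments.
Unset Strict Implicit.
Unset Printing Implicit Defensive.

Import GRing.Theory.

(** A product [R_d * R_e] is all of [R_(d + e)] as soon as every
    representation of dimension vector [d + e] has a subrepresentation of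
    dimension vector [e].  Both relations of the theorem hold because each of
    the four products is the whole representation space of its dimension
    vector, and the two sides of a relation have the same dimension vector.

    In the following products, subrepresentations of the right dimension are
    always available.
    - [R_i^m] and [R_i^p * R_j^q]: no arrow leads from the support of the
      second factor to that of the first, so that every subspace of the
      required dimension is stable ([star_full_no_arrow]).
    - [(R_i^n * R_j) * R_i]: a representation consists of [n] linear forms
      on [k^(n+1)] and these have a common nonzero zero, which spans a copy of
      the simple module at [i] ([star_full_joint_kernel]).
    - [R_j * (R_i * R_j^n)]: dually, a representation consists of [n] vectors
      of [k^(n+1)], which lie in a common hyperplane; the quotient by it is the
      simple module at [j] ([star_full_joint_image]).

    Since there are no loops and no arrows from [j] to [i], only the [n] arrows
    from [i] to [j] act, whence the linear forms and the vectors above.  This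
    supposes that [i] and [j] differ; otherwise both sides of each relation
    are the same power of [R_i]. *)

Local Open Scope ring_scope.

(** * Subspaces of prescribed dimension *)

(** The rows of [row_ebase S] form a basis of the whole space that starts with
    a basis of [S], so its first [r] rows span a space comparable with [S]. *)
Lemma row_free_comparable (k : fieldType) (r n : nat) (S : 'M[k]_n) :
  (r <= n)%N ->
  exists U : 'M[k]_(r, n),
    [/\ row_free U, (\rank S <= r)%N -> (S <= U)%MS
      & (r <= \rank S)%N -> (U <= S)%MS].
Proof.
move=> le_rn; exists (pid_mx r *m row_ebase S); split.
- by rewrite /row_free mxrankMfree ?rank_pid_mx // row_free_unit row_ebase_unit.
- move=> le_Sr; rewrite -{1}(mulmx_ebase S).
  have -> : pid_mx (\rank S)
      = (pid_mx (\rank S) : 'M_(n, r)) *m pid_mx r :> 'M[k]_n.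
    by rewrite mul_pid_mx (minn_idPl le_Sr) (minn_idPr le_Sr).
  by rewrite -!mulmxA mulmxA submxMl.
move=> le_rS.
have -> : pid_mx r *m row_ebase S
    = (pid_mx r : 'M_(r, n)) *m invmx (col_ebase S) *m S.
  rewrite -{3}(mulmx_ebase S) -mulmxA -(mulmxA (col_ebase S)).
  rewrite (mulKmx (col_ebase_unit S)) mulmxA mul_pid_mx.
  by rewrite (minn_idPl le_rS) (minn_idPr le_rn).
exact: submxMl.
Qed.

(** Each of the kernels has codimension at most the number of columns. *)
Lemma rank_bigcap_ker (k : fieldType) (I : finType) (P : pred I) (n : nat)
    (q : I -> nat) (A : forall a, 'M[k]_(n, q a)) :
  (n <= \rank (\bigcap_(a | P a) kermx (A a))%MS + \sum_(a | P a) q a)%N.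
Proof.
elim/big_rec2: _ => [|a K s _ leK]; first by rewrite mxrank1 addn0.
have le_qa : (n <= \rank (kermx (A a)) + q a)%N.
  by rewrite mxrank_ker; have := rank_leq_col (A a); lia.
have := mxrank_sum_cap (kermx (A a)) K.
have := rank_leq_row (kermx (A a) + K)%MS.
by move: le_qa leK; lia.
Qed.

Section FullProducts.
Variables (k : fieldType) (Q : quiver).
Implicit Types d e : dimvec Q.

(** * Criteria for a product of full representation spaces to be full *)

(** The matrices of a stable family of subspaces, used as an inclusion, and of
    its cokernel yield the exact sequence. *)
Lemma stable_short_exact d e (X : rep k (d + e))
    (U : forall v, 'M[k]_(e v, (d + e)%R v)) :
  (forall v, row_free (U v)) ->
  (forall a, (U (src a) *m X a <= U (tgt a))%MS) ->
  exists (N : rep k e) (M : rep k d), short_exact N X M.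
Proof.
move=> Ufree Ustable.
have exg v : exists g : 'M[k]_((d + e)%R v, d v),
    row_full g /\ (U v == kermx g)%MS.
  have [|g [gfull kerg]] := @rank_col_basis _ _ (d v) _ (cokermx (U v)).
    by rewrite mxrank_coker (eqP (Ufree v)) ffunE addnK.
  exists g; split=> //; apply: exact_mxI => //; last by rewrite ffunE.
  by apply/eqP; rewrite -sub_kermx kerg sub_kermx mulmx_coker.
have [g gP] := fin_all_exists exg.
pose N : rep k e := fun a => U (src a) *m X a *m pinvmx (U (tgt a)).
pose M : rep k d := fun a => pinvmx (g (src a)) *m (X a *m g (tgt a)).
have UH : is_hom N X U by move=> a; rewrite /N mulmxKpV.
exists N, M, U, g; split=> // [a|v]; last by case: (gP v).
have [gfull gker] := gP (src a); have [_ gker'] := gP (tgt a).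
rewrite /M full_factor //.
have /submxP [D ->] : (kermx (g (src a)) <= U (src a))%MS.
  by rewrite (eqmxP gker).
by rewrite -mulmxA [U _ *m _]mulmxA UH -!mulmxA (exact_mx0 gker') !mulmx0.
Qed.

Lemma star_full d e :
  (forall X : rep k (d + e), exists U : forall v, 'M[k]_(e v, (d + e)%R v),
     (forall v, row_free (U v)) /\
     (forall a, (U (src a) *m X a <= U (tgt a))%MS)) ->
  star (full_repset k d) (full_repset k e) = full_repset k (d + e).
Proof.
move=> exU; congr RepSet; apply/classical_sets.seteqP; split=> // X _ /=.
have [U [Ufree Ustable]] := exU X.
by have [N [M NXM]] := stable_short_exact Ufree Ustable; exists M, N.
Qed.

Lemma dimvecDE d e v : (d + e) v = (d v + e v)%N.
Proof. by rewrite ffunE. Qed.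

Lemma leq_dim_sub d e v : (e v <= (d + e)%R v)%N.
Proof. by rewrite dimvecDE leq_addl. Qed.

(** At the source of an arrow every subspace is zero, or at its target every
    subspace is everything. *)
Lemma star_full_no_arrow d e :
  (forall a : arrow Q, e (src a) = 0%N \/ d (tgt a) = 0%N) ->
  star (full_repset k d) (full_repset k e) = full_repset k (d + e).
Proof.
move=> de0; apply: star_full => X.
have exU v := row_free_comparable (0 : 'M[k]_((d + e)%R v)) (leq_dim_sub d e v).
have [U UP] := fin_all_exists exU.
exists U; split=> [v|a]; first by case: (UP v).
have [e0|d0] := de0 a.
  suff -> : U (src a) = 0 by rewrite mul0mx sub0mx.
  by apply/eqP; rewrite -mxrank_eq0 -leqn0 -e0 rank_leq_row.
apply: submx_full; have [Ufree _ _] := UP (tgt a).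
by rewrite /row_full (eqP Ufree) ffunE d0.
Qed.

(** By the dimension bound, the joint kernel of the arrows out of [v] has
    dimension at least [e v], and every subspace of it is stable. *)
Lemma star_full_joint_kernel d e :
  (forall v, (0 < e v)%N ->
     (\sum_(a : arrow Q | src a == v) (d + e)%R (tgt a) <= d v)%N) ->
  star (full_repset k d) (full_repset k e) = full_repset k (d + e).
Proof.
move=> sum_le; apply: star_full => X.
(* The factor pid_mx is the identity whenever src a = v; it only serves to give
   X a a source space that does not mention a. *)
pose K v := (\bigcap_(a : arrow Q | src a == v)
  kermx (pid_mx ((d + e)%R v) *m X a : 'M[k]_((d + e)%R v, _)))%MS.
have exU v := row_free_comparable (K v) (leq_dim_sub d e v).
have [U UP] := fin_all_exists exU.
exists U; split=> [v|a]; first by case: (UP v).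
suff -> : U (src a) *m X a = 0 by apply: sub0mx.
have [_ _ UK] := UP (src a).
have le_eK : (e (src a) <= \rank (K (src a)))%N.
  have [->//|e_gt0] := posnP (e (src a)).
  have := rank_bigcap_ker (fun b => src b == src a)
    (fun b => pid_mx ((d + e)%R (src a)) *m X b : 'M[k]_((d + e)%R (src a), _)).
  rewrite -/(K _); move: (sum_le _ e_gt0); rewrite [X in (X <= _ + _)%N]dimvecDE.
  by move: (\rank _) (\sum_(_ | _) _)%N; lia.
apply/eqP; rewrite -sub_kermx (submx_trans (UK le_eK)) //.
by rewrite (bigcapmx_inf a) // pid_mx_1 mul1mx.
Qed.

(** By the dimension bound, the images of the arrows into [v] lie in a common
    subspace of dimension [e v], and such a family of subspaces is stable. *)
Lemma star_full_joint_image d e :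
  (forall v, (0 < d v)%N ->
     (\sum_(a : arrow Q | tgt a == v) (d + e)%R (src a) <= e v)%N) ->
  star (full_repset k d) (full_repset k e) = full_repset k (d + e).
Proof.
move=> sum_le; apply: star_full => X.
(* As for joint kernels, pid_mx is the identity whenever tgt a = v. *)
pose S v := (\sum_(a : arrow Q | tgt a == v)
  <<(X a *m pid_mx ((d + e)%R v) : 'M[k]_(_, (d + e)%R v))>>)%MS.
have exU v := row_free_comparable (S v) (leq_dim_sub d e v).
have [U UP] := fin_all_exists exU.
exists U; split=> [v|a]; first by case: (UP v).
have [_ SU _] := UP (tgt a).
apply: submx_trans (submxMl _ _) (submx_trans _ (SU _)).
  by rewrite (sumsmx_sup a) // genmxE pid_mx_1 mulmx1.
have [d0|d_gt0] := posnP (d (tgt a)).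
  by rewrite (leq_trans (rank_leq_row _)) // ffunE d0.
apply: leq_trans (sum_le _ d_gt0).
rewrite (leq_trans (mxrank_sum_leqif _)) //=.
by apply: leq_sum => b _; rewrite genmxE rank_leq_row.
Qed.

(** * Products of simple representations *)

Lemma sigma_mulrnE (i v : vertex Q) m : (sigma i *+ m) v = ((v == i) * m)%N.
Proof. by elim: m => [|m IHm]; rewrite ?muln0 ?mulrS ?mulnS !ffunE ?IHm. Qed.

Lemma acyclic_no_loop (a : arrow Q) : acyclic Q -> tgt a != src a.
Proof. by move=> /(_ a [::]) /=; rewrite andbT. Qed.

(** Unfolds one product only: simplification would also unfold the products and
    powers inside its factors. *)
Lemma comp_valM (A B : comp_monoid k Q) : (A * B)%g = star A B :> repset k Q.
Proof. by []. Qed.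

Hypothesis acyclicQ : acyclic Q.

Lemma comp_gen_expE (i : vertex Q) m :
  (comp_gen k i ^+ m)%g = full_repset k (sigma i *+ m) :> repset k Q.
Proof.
elim: m => [|m IHm]; first by rewrite mulr0n.
rewrite expgS mulrS /= IHm; apply: star_full_no_arrow => a.
rewrite sigma_mulrnE ffunE; have := acyclic_no_loop a acyclicQ.
by case: (src a =P i) => [->|_]; [move/negPf->; right | left].
Qed.

Lemma comp_gen_exp_mulE (i j : vertex Q) p q : arrows j i = set0 ->
  (comp_gen k i ^+ p * comp_gen k j ^+ q)%g
    = full_repset k (sigma i *+ p + sigma j *+ q) :> repset k Q.
Proof.
move=> no_ji; rewrite /= !comp_gen_expE; apply: star_full_no_arrow => a.
rewrite !sigma_mulrnE; have /setP/(_ a) := no_ji; rewrite !inE.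
by case: (src a == j) => /= [->|_]; [right | left].
Qed.

(** In the absence of loops, [w] is never evaluated at [i]. *)
Lemma sum_tgt_out (i j : vertex Q) (w : vertex Q -> nat) :
  (forall v, v != i -> w v = (v == j)) ->
  (\sum_(a : arrow Q | src a == i) w (tgt a) = #|arrows i j|)%N.
Proof.
move=> wE; rewrite cardsE -sum1_card [RHS]big_mkcondr /=.
apply: eq_bigr => a /eqP src_a.
rewrite wE; last by rewrite -src_a acyclic_no_loop.
by case: (tgt a == j).
Qed.

Lemma sum_src_in (i j : vertex Q) (w : vertex Q -> nat) :
  (forall v, v != j -> w v = (v == i)) ->
  (\sum_(a : arrow Q | tgt a == j) w (src a) = #|arrows i j|)%N.
Proof.
move=> wE; rewrite cardsE -sum1_card [RHS]big_mkcondl /=.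
apply: eq_bigr => a /eqP tgt_a.
rewrite wE; last by rewrite -tgt_a eq_sym acyclic_no_loop.
by case: (src a == i).
Qed.

End FullProducts.

Theorem corollary5p4 (k : closedFieldType) (Q : quiver) (i j : vertex Q)
    (char0 : [pchar k]%R =i pred0) (acyclicQ : acyclic Q)
    (no_arrow_ji : arrows j i = set0) :
  let n := #|arrows i j| in
  let R : vertex Q -> comp_monoid k Q := comp_gen k in
  (R i ^+ n.+1 * R j = R i ^+ n * R j * R i)%g /\
  (R i * R j ^+ n.+1 = R j * R i * R j ^+ n)%g.
Proof.
move=> n R; have [<-|neq_ij] := eqVneq i j.
  by rewrite [in LHS]expgSr expgS mulgA.
have exp_mulE p q : (R i ^+ p * R j ^+ q)%g
    = full_repset k (sigma i *+ p + sigma j *+ q)%R :> repset k Q.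
  exact: comp_gen_exp_mulE.
split; apply: comp_val_inj.
- (* R_j counts as a first power, so that R_i^m * R_j is full by exp_mulE. *)
  rewrite -[R j]expg1 exp_mulE mulr1n.
  transitivity (full_repset k (sigma i *+ n + sigma j + sigma i)%R).
    by rewrite addrAC -mulrSr.
  symmetry; rewrite comp_valM exp_mulE.
  apply: star_full_joint_kernel => v.
  rewrite ffunE; case: (v =P i) => [-> _|//].
  rewrite (sum_tgt_out acyclicQ (j := j)) => [|u /negPf neq_ui].
    by rewrite dimvecDE sigma_mulrnE eqxx mul1n leq_addr.
  by rewrite !dimvecDE sigma_mulrnE !ffunE neq_ui mul0n addn0.
- rewrite -mulgA -[R i]expg1 exp_mulE mulr1n.
  transitivity (full_repset k (sigma j + (sigma i + sigma j *+ n))%R).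
    by rewrite addrCA -mulrS.
  symmetry; rewrite comp_valM exp_mulE.
  apply: star_full_joint_image => v.
  rewrite ffunE; case: (v =P j) => [-> _|//].
  rewrite (sum_src_in acyclicQ (i := i)) => [|u /negPf neq_uj].
    by rewrite dimvecDE [(sigma j *+ n)%R j]sigma_mulrnE eqxx mul1n leq_addl.
  by rewrite !dimvecDE [(sigma j *+ n)%R u]sigma_mulrnE !ffunE neq_uj mul0n addn0.
Qed.
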